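(* Let $\mathcal{B}=[0,1]^2$ and let $\mathbb{P}$ have moves $\mathbf{m}_1=(c_1,d_1)$, $\mathbf{m}_2=(c_2,d_2)$ satisfying $0<\frac{d_1}{c_1}<1<\frac{d_2}{c_2}$. Then the denominator of $([0,1]^{2q},\mathcal{A}_{\mathbb{P}}^q)$ is the least common multiple of the denominators of the first $q$ terms of the sequence defined for $i\ge1$ by \[\begin{cases}\left(1,\left(\frac{d_1c_2}{c_1d_2}\right)^{\frac{i-1}{2}}\right) & i\text{ odd},\\ \left(\frac{d_1}{c_1}\left(\frac{d_1c_2}{c_1d_2}\right)^{\frac i2-1},\ \frac{c_2}{d_2}\left(\frac{d_1c_2}{c_1d_2}\right)^{\frac i2-1}\right) & i\text{ even},\end{cases}\] and the denominators of the first $\lfloor (q-1)/2\rfloor$ terms of the sequence defined for $i\ge1$ by \[\begin{cases}\left(\frac{d_1c_2}{c_1d_2}\right)^{\frac{i-1}{2}}\left(\frac{c_2(d_1-c_1)}{c_1d_2-c_2d_1},\ \frac{d_1(d_2-c_2)}{c_1d_2-c_2d_1}\right) & i\text{ odd},\\ \left(\frac{d_1c_2}{c_1d_2}\right)^{\frac i2}\left(\frac{c_1(c_2-d_2)}{c_1d_2-c_2d_1},\ \frac{d_2(c_1-d_1)}{c_1d_2-c_2d_1}\right) & i\text{ even}.\end{cases}\]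
   Context: $\mathbb{P}$ is a two-move rider: its basic moves $\mathbf{m}_1,\mathbf{m}_2$ are nonparallel vectors with relatively prime integer coordinates. For $\mathbf{z}=(\mathbf{z}_1,\dots,\mathbf{z}_q)\in\mathbb{R}^{2q}$, attack equations are the hyperplanes $(\mathbf{z}_i-\mathbf{z}_j)\cdot(d_r,-c_r)=0$ for $i\ne j$, $r\in\{1,2\}$, forming the arrangement $\mathcal{A}_{\mathbb{P}}^q$; fixations are the hyperplanes $x_i=0$, $x_i=1$, $y_i=0$, $y_i=1$ where $\mathbf{z}_i=(x_i,y_i)$. A vertex of the inside-out polytope $([0,1]^{2q},\mathcal{A}_{\mathbb{P}}^q)$ is a point of $[0,1]^{2q}$ that is the unique common point of some collection of attack equations and fixations. The denominator of a rational point is the lcm of the denominators of its coordinates, and the denominator of the inside-out polytope is the lcm of the denominators of all its vertices. *)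

(* Defs.v *)
From HB Require Import structures.
From mathcomp Require Export all_boot all_order all_algebra.
From mathcomp Require Export boolp classical_sets reals.
Export Order.TTheory GRing.Theory Num.Theory.

Set Implicit Arguments.
Unset Strict Implicit.
Unset Printing Implicit Defensive.

Local Open Scope classical_set_scope.
Local Open Scope ring_scope.

Definition nonparallel (m1 m2 : int * int) : Prop :=
  m1.1 * m2.2 - m2.1 * m1.2 != 0.

Definition two_move_rider (m1 m2 : int * int) : Prop :=
  [/\ coprimez m1.1 m1.2, coprimez m2.1 m2.2 & nonparallel m1 m2].

(* R^(2q), as q-tuples of points z_i = (x_i, y_i) of the plane. *)
Definition config (R : realType) (q : nat) := {ffun 'I_q -> R * R}.

Definition unit_cube (R : realType) (q : nat) : set (config R q) :=
  [set z | forall i, 0 <= (z i).1 <= 1 /\ 0 <= (z i).2 <= 1].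

Definition attack_hyperplane (R : realType) (q : nat) (m : int * int)
    (i j : 'I_q) : set (config R q) :=
  [set z | ((z i).1 - (z j).1) * m.2%:~R + ((z i).2 - (z j).2) * (- m.1%:~R)
           = 0].

Definition attack_equations (R : realType) (q : nat) (m1 m2 : int * int) :
    set (set (config R q)) :=
  [set H | exists m i j, [/\ m \in [:: m1; m2], i != j &
                             H = attack_hyperplane m i j]].

Definition fixations (R : realType) (q : nat) : set (set (config R q)) :=
  [set H | exists i : 'I_q,
     [\/ H = [set z : config R q | (z i).1 = 0],
         H = [set z : config R q | (z i).1 = 1],
         H = [set z : config R q | (z i).2 = 0] |
         H = [set z : config R q | (z i).2 = 1]]].

Definition is_vertex (R : realType) (q : nat) (m1 m2 : int * int)
    (z : config R q) : Prop :=
  unit_cube z /\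
  exists2 C : set (set (config R q)),
    C `<=` attack_equations m1 m2 `|` @fixations R q &
    \bigcap_(H in C) H = [set z].

Definition rat_denom (r : rat) : nat := `|denq r|%N.

(* Irrational numbers get the junk denominator 0, which divides only 0: a
   positive common multiple of denominators thus certifies rationality. *)
Definition real_denom (R : realType) (x : R) : nat :=
  if pselect (exists r : rat, x = ratr r) is left h
  then rat_denom (projT1 (cid h)) else 0%N.

Definition config_denom (R : realType) (q : nat) (z : config R q) : nat :=
  \big[lcmn/1%N]_(i < q) lcmn (real_denom (z i).1) (real_denom (z i).2).

Definition is_lcm (S : set nat) (D : nat) : Prop :=
  (forall n, S n -> n %| D)%N /\
  (forall E, (forall n, S n -> n %| E) -> D %| E)%N.

Definition is_polytope_denom (R : realType) (q : nat) (m1 m2 : int * int)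
    (D : nat) : Prop :=
  is_lcm [set n | exists2 z : config R q, is_vertex m1 m2 z & n = config_denom z]
         D.

Definition point_denom (p : rat * rat) : nat :=
  lcmn (rat_denom p.1) (rat_denom p.2).

Definition slope_ratio (c1 d1 c2 d2 : rat) : rat := (d1 * c2) / (c1 * d2).

Definition move_det (c1 d1 c2 d2 : rat) : rat := c1 * d2 - c2 * d1.

(* Both sequences are indexed from 1; the value at index 0 is junk. *)
Definition seq1 (c1 d1 c2 d2 : rat) (i : nat) : rat * rat :=
  let rho := slope_ratio c1 d1 c2 d2 in
  if odd i then (1, rho ^+ (i - 1)./2)
  else (d1 / c1 * rho ^+ (i./2 - 1), c2 / d2 * rho ^+ (i./2 - 1)).

Definition seq2 (c1 d1 c2 d2 : rat) (i : nat) : rat * rat :=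
  let rho := slope_ratio c1 d1 c2 d2 in
  let delta := move_det c1 d1 c2 d2 in
  if odd i then (rho ^+ (i - 1)./2 * (c2 * (d1 - c1) / delta),
                 rho ^+ (i - 1)./2 * (d1 * (d2 - c2) / delta))
  else (rho ^+ i./2 * (c1 * (c2 - d2) / delta),
        rho ^+ i./2 * (d2 * (c1 - d1) / delta)).

(* Main.v *)
Require Import Defs.
From mathcomp Require Import ring lra zify.

Set Implicit Arguments.
Unset Strict Implicit.
Unset Printing Implicit Defensive.

Local Open Scope classical_set_scope.
Local Open Scope ring_scope.

(* Put the origin at the corner (1, 0), i.e. X = 1 - x and Y = y, and let
   a = d1 / c1 and b = c2 / d2, both in ]0, 1[. Lines of the two directions are
   the level sets of t = Y + a X and s = X + b Y.  A point of the cube is a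
   vertex iff its incidences (shared lines and sides) leave it no freedom, that
   is, iff every line carrying a piece is tied to a corner by boundary pieces.
   Following such ties away from a corner produces a zigzag between two adjacent
   sides, whose k-th point is at distance [geom a b k] or [geom b a k] from the
   corner (1, 0) (or (0, 1), by central symmetry).  If a piece of the zigzag is
   missing, everything beyond it can be dilated about that corner; a line
   joining opposite sides can be moved together with the two chains hanging at
   its ends.  So the pieces of a vertex are on zigzags, or at intersections of
   two zigzags.  The two zigzags accumulating at the same corner only cross
   along edges of equal index, so that the n-th crossing (n >= 0) takes 2 n + 3
   pieces: n + 1 on each zigzag and one at the crossing. *)

(** The alternating product [a * b * a * ...] with [n] factors. Exchanging [a] and [b] at each step
    matches [swap], which leads from one side to the next. *)
Fixpoint geom (K : fieldType) (a b : K) n : K :=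
  if n is m.+1 then a * geom b a m else 1.

(* Intersection of the lines [t = geom a b n.+1] and [s = geom b a n.+1]. *)
Definition crossing (K : fieldType) (a b : K) n : K * K :=
  ((geom b a n.+1 - geom b a n.+2) / (1 - a * b),
   (geom a b n.+1 - geom a b n.+2) / (1 - a * b)).

(** * Symmetries of the square and rigid configurations *)

Section Plane.
Variable R : realType.
Implicit Types (a b c r u x : R) (p : R * R).

Definition swap p : R * R := (p.2, p.1).
Definition mirror p : R * R := (1 - p.1, 1 - p.2).
(** [tc a] is the level t; s is [tc b] after [swap], so each fact about the first direction yields
    one about the second. *)
Definition tc a p : R := p.2 + a * p.1.
Definition in_square p := (0 <= p.1 <= 1) && (0 <= p.2 <= 1).

Lemma tc_mirror a p : tc a (mirror p) = 1 + a - tc a p.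
Proof. rewrite /tc /=; ring. Qed.

Lemma in_square_swap p : in_square p -> in_square (swap p).
Proof. by rewrite /in_square andbC. Qed.

Lemma in_square_mirror p : in_square p -> in_square (mirror p).
Proof. rewrite /in_square /=; lra. Qed.

(* [w'] lies on every hyperplane of the arrangement that contains [w]. *)
Record compatible q a b (w w' : 'I_q -> R * R) : Prop := Compatible {
  compat_t : forall i j, tc a (w i) = tc a (w j) -> tc a (w' i) = tc a (w' j);
  compat_s : forall i j, tc b (swap (w i)) = tc b (swap (w j)) ->
                         tc b (swap (w' i)) = tc b (swap (w' j));
  compat_X : forall i, (w i).1 \in [:: 0; 1] -> (w' i).1 = (w i).1;
  compat_Y : forall i, (w i).2 \in [:: 0; 1] -> (w' i).2 = (w i).2 }.

Definition rigid q a b (w : 'I_q -> R * R) :=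
  forall w', compatible a b w w' -> w' =1 w.

Lemma swapK : involutive swap. Proof. by case. Qed.
Lemma mirrorK : involutive mirror.
Proof. by case=> x y; rewrite /mirror /=; congr (_, _); ring. Qed.

Lemma rigid_swap q a b (w : 'I_q -> R * R) :
  rigid a b w -> rigid b a (swap \o w).
Proof.
move=> rw w' [/= ct cs cX cY] i /=.
rewrite -[w' i]swapK; congr swap.
apply: (rw (swap \o w')); by split.
Qed.

Lemma rigid_mirror q a b (w : 'I_q -> R * R) :
  rigid a b w -> rigid a b (mirror \o w).
Proof.
have bit x : (1 - x \in [:: 0; 1]) = (x \in [:: 0; 1]).
  rewrite !inE orbC; congr (_ || _); apply/eqP/eqP => ?; lra.
move=> rw w' [/= ct cs cX cY] i /=.
rewrite -[w' i]mirrorK; congr mirror.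
have E b' p : tc b' (swap (mirror p)) = 1 + b' - tc b' (swap p).
  by rewrite -tc_mirror.
apply: (rw (mirror \o w')); split => /= [j k h|j k h|j h|j h].
- by rewrite !tc_mirror (ct j k) // !tc_mirror h.
- by rewrite !E (cs j k) // !E h.
- rewrite cX ?bit //; ring.
- rewrite cY ?bit //; ring.
Qed.

(** * Displacements along chains of lines *)

(* Infinitesimally, a displacement assigns to each line of the first (second)
   direction a shift [f t] ([g s]); a piece on a vertical (horizontal) side
   stays there iff [g s = b * f t] ([f t = a * g s]). *)
Lemma rigid_shift0 q a b (w : 'I_q -> R * R) (f g : R -> R) :
    a * b < 1 -> rigid a b w ->
    (forall i, (w i).1 \in [:: 0; 1] ->
       g (tc b (swap (w i))) = b * f (tc a (w i))) ->
    (forall i, (w i).2 \in [:: 0; 1] ->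
       f (tc a (w i)) = a * g (tc b (swap (w i)))) ->
  forall i, f (tc a (w i)) = 0.
Proof.
move=> ab1 rw hX hY i.
have D0 : 1 - a * b != 0 by lra.
pose w' j :=
  ((w j).1 + (g (tc b (swap (w j))) - b * f (tc a (w j))) / (1 - a * b),
   (w j).2 + (f (tc a (w j)) - a * g (tc b (swap (w j)))) / (1 - a * b)).
have tE j : tc a (w' j) = tc a (w j) + f (tc a (w j)).
  by rewrite /w' {1}/tc /= {5}/tc; field.
have sE j : tc b (swap (w' j)) = tc b (swap (w j)) + g (tc b (swap (w j))).
  by rewrite /w' {1}/tc /= {5}/tc /=; field.
have /(_ i) e : w' =1 w.
  apply: rw; split=> [j k h|j k h|j h|j h]; rewrite ?tE ?sE ?h //=.
  - by rewrite (hX _ h) subrr mul0r addr0.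
  - by rewrite (hY _ h) subrr mul0r addr0.
by move: (tE i); rewrite e => h; lra.
Qed.

(* The infinitesimal dilation about the corner, restricted to the lines
   [u * r ^+ k].  By [chainX] and [chainY] it respects the sides, except at the
   outer end of the line [t = u]. *)
Definition chain r u x : R := if `[< exists k, x = u * r ^+ k >] then x else 0.

Lemma chain_id r u : chain r u u = u.
Proof.
by rewrite /chain; case: asboolP => // -[]; exists 0%N; rewrite expr0 mulr1.
Qed.

Lemma chain_gt r u x : 0 <= r <= 1 -> 0 <= u -> u < x -> chain r u x = 0.
Proof.
move=> /andP[r0 r1] u0 ux; rewrite /chain; case: asboolP => // -[k xE].
have := exprn_ile1 k r0 r1; nra.
Qed.

Lemma chain_scale r c u x : c != 0 -> chain r (c * u) (c * x) = c * chain r u x.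
Proof.
move=> c0; rewrite /chain.
have -> : (exists k, c * x = c * u * r ^+ k) = (exists k, x = u * r ^+ k).
  apply/propext; split=> -[k h]; exists k; last by rewrite h mulrA.
  by apply: (mulfI c0); rewrite h mulrA.
by case: asboolP => //; rewrite mulr0.
Qed.

Lemma chain_cons r u x : x != u -> chain r u x = chain r (r * u) x.
Proof.
move=> xu; rewrite /chain.
have -> // : (exists k, x = u * r ^+ k) = (exists k, x = r * u * r ^+ k).
apply/propext; split=> -[]; last first.
  by move=> k ->; exists k.+1; rewrite exprS; ring.
case=> [|k] h; first by rewrite h expr0 mulr1 eqxx in xu.
by exists k; rewrite h exprS; ring.
Qed.

(** On [X = 0], [s = b * t], so the chains correspond exactly. On [X = 1], s is at least 1, beyond
    its chain, and t is at least [a], so only the first term [u] of its chain can be met. *)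
Lemma chainX a b u p : 0 < a < 1 -> 0 < b < 1 -> 0 < u < 1 -> in_square p ->
  p.1 \in [:: 0; 1] ->
  chain (a * b) (b * u) (tc b (swap p))
  = b * chain (a * b) u (tc a p) -
    (if (p.1 == 1) && (tc a p == u) then b * u else 0).
Proof.
case: p => X Y; rewrite /in_square /tc /= => ha hb hu hp.
have r01 : 0 <= a * b <= 1 by apply/andP; split; nra.
rewrite !inE => /orP[]/eqP->.
  rewrite eq_sym oner_eq0 /= add0r mulr0 addr0 subr0 chain_scale //; lra.
rewrite eqxx /= mulr1 chain_gt //; [|nra|nra].
case: eqVneq => [->|ne]; first by rewrite chain_id subrr.
by rewrite chain_cons // chain_gt ?mulr0 ?subr0 //; nra.
Qed.

(** On [Y = 0], [t = a * s], so dropping the first term [u] of one chain leaves [a] times the other.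
    On [Y = 1] both levels lie beyond their chains. *)
Lemma chainY a b u p : 0 < a < 1 -> 0 < b < 1 -> 0 < u < 1 -> in_square p ->
  p.2 \in [:: 0; 1] ->
  chain (a * b) u (tc a p)
  = a * chain (a * b) (b * u) (tc b (swap p)) +
    (if (p.2 == 0) && (tc a p == u) then u else 0).
Proof.
case: p => X Y; rewrite /in_square /tc /= => ha hb hu hp.
have r01 : 0 <= a * b <= 1 by apply/andP; split; nra.
rewrite !inE => /orP[]/eqP->; last first.
  by rewrite oner_eq0 /= !chain_gt ?mulr0 ?addr0 //; nra.
rewrite eqxx /= mulr0 addr0 add0r.
case: eqVneq => [aX|ne].
  rewrite aX chain_id chain_gt ?mulr0 ?add0r //; last first.
    by rewrite -aX; nra.
  nra.
by rewrite chain_cons // -mulrA chain_scale ?addr0 //; lra.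
Qed.

(** * Lines that a rigid configuration can occupy *)

Definition occupied q (w : 'I_q -> R * R) p := exists i, w i = p.

Definition rigid_in_square q a b (w : 'I_q -> R * R) :=
  rigid a b w /\ forall i, in_square (w i).

Lemma rigid_in_square_swap q a b (w : 'I_q -> R * R) :
  rigid_in_square a b w -> rigid_in_square b a (swap \o w).
Proof.
by case=> rw sw; split=> [|i]; [apply: rigid_swap|apply: in_square_swap].
Qed.

Lemma rigid_in_square_mirror q a b (w : 'I_q -> R * R) :
  rigid_in_square a b w -> rigid_in_square a b (mirror \o w).
Proof.
by case=> rw sw; split=> [|i]; [apply: rigid_mirror|apply: in_square_mirror].
Qed.

(** If that point were free, the chain starting at [t = u] would respect every side: its only
    possible defect is at the outer end of this line, which for [u <= a] is that very point.
    Rigidity would then make [u] vanish. *)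
Lemma occupied_bottom q a b (w : 'I_q -> R * R) i :
    0 < a < 1 -> 0 < b < 1 -> rigid_in_square a b w ->
  0 < tc a (w i) <= a -> occupied w (tc a (w i) / a, 0).
Proof.
move=> ha hb [rw sw] ti; set u := tc a (w i) in ti *.
apply: contrapT => nocc.
have ab1 : a * b < 1 by nra.
have u01 : 0 < u < 1 by lra.
have free j : tc a (w j) = u -> (w j).2 <> 0.
  move=> tj Yj; apply: nocc; exists j; rewrite -tj.
  move: Yj; rewrite /tc; case: (w j) => X Y /= ->; congr (_, _).
  by field; lra.
have := @rigid_shift0 _ a b w (chain (a * b) u) (chain (a * b) (b * u)) ab1 rw.
have h1 j : (w j).1 \in [:: 0; 1] ->
  chain (a * b) (b * u) (tc b (swap (w j))) = b * chain (a * b) u (tc a (w j)).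
  move=> hX; rewrite (chainX ha hb) //; case: ifP => [|_]; last by rewrite subr0.
  case/andP => /eqP X1 /eqP tj; case: (free j tj).
  by move: tj (sw j); rewrite /tc /in_square X1; lra.
have h2 j : (w j).2 \in [:: 0; 1] ->
  chain (a * b) u (tc a (w j)) = a * chain (a * b) (b * u) (tc b (swap (w j))).
  move=> hY; rewrite (chainY ha hb) //; case: ifP => [|_]; last by rewrite addr0.
  by case/andP => /eqP Y0 /eqP tj; case: (free j tj).
by move=> /(_ h1 h2 i); rewrite -/u chain_id; lra.
Qed.

(* A line [t = u] joining the two vertical sides is displaced together with
   the chains starting at both of its ends; the factor [u / u'] matches the two
   displacements on that line. *)
Lemma no_transversal q a b (w : 'I_q -> R * R) i :
    0 < a < 1 -> 0 < b < 1 -> rigid_in_square a b w ->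
  ~ (a < tc a (w i) < 1).
Proof.
move=> ha hb [rw sw] ti; set u := tc a (w i) in ti.
have ab1 : a * b < 1 by nra.
have u01 : 0 < u < 1 by lra.
have ba : b * a = a * b by rewrite mulrC.
have r01 : 0 <= a * b <= 1 by apply/andP; split; nra.
pose u' := 1 + a - u; have u'01 : 0 < u' < 1 by rewrite /u'; lra.
have bu'01 : 0 < b * u' < 1 by apply/andP; split; nra.
(* Seen through [mirror], the second chain starts with the line of the other direction through the
   end of [t = u] on [X = 1]. Its defect there, times [u / u'], is [b * u] and cancels that of the
   first chain. *)
pose f t :=
  chain (a * b) u t + u / u' * chain (a * b) (a * (b * u')) (1 + a - t).
pose g s :=
  chain (a * b) (b * u) s + u / u' * chain (a * b) (b * u') (1 + b - s).
have E c p : tc c (swap (mirror p)) = 1 + c - tc c (swap p).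
  by rewrite -tc_mirror.
have bit x : x \in [:: 0; 1] -> 1 - x \in [:: 0; 1].
  by rewrite !inE => /orP[]/eqP->; apply/orP; [right|left]; apply/eqP; ring.
have sm j : in_square (swap (mirror (w j))).
  by apply/in_square_swap/in_square_mirror.
have h1 j : (w j).1 \in [:: 0; 1] -> g (tc b (swap (w j))) = b * f (tc a (w j)).
  move=> hX; rewrite /g /f (chainX ha hb u01) //.
  have := chainY hb ha bu'01 (sm j) (bit _ hX).
  rewrite ba swapK E tc_mirror => ->; rewrite /=.
  have -> : (1 - (w j).1 == 0) = ((w j).1 == 1) by rewrite subr_eq0 eq_sym.
  case: eqVneq => [X1|_] /=; last by rewrite !addr0 subr0; ring.
  have -> : (1 + b - tc b (swap (w j)) == b * u') = (tc a (w j) == u).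
    apply/eqP/eqP; rewrite /u' /tc /= X1 => h; last by nra.
    by apply: (@mulfI _ b); [lra | lra].
  case: eqP => _; last by rewrite !addr0 subr0; ring.
  by field; lra.
have h2 j : (w j).2 \in [:: 0; 1] -> f (tc a (w j)) = a * g (tc b (swap (w j))).
  move=> hY; rewrite /g /f (chainY ha hb u01) //.
  have := chainX hb ha bu'01 (sm j) (bit _ hY).
  rewrite ba swapK E tc_mirror => ->; rewrite /=.
  rewrite !ifF ?subr0 ?addr0; first by ring.
    apply/negP => /andP[/eqP Y0 /eqP]; rewrite /tc /=; move: (sw j).
    by rewrite /in_square; nra.
  apply/negP => /andP[/eqP Y0 /eqP]; rewrite /tc Y0; move: (sw j).
  rewrite /in_square.
  nra.
have := @rigid_shift0 _ a b w f g ab1 rw h1 h2 i.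
rewrite /f -/u chain_id chain_gt //; [lra|nra|].
rewrite -/u'; nra.
Qed.

(** * Zigzags and the classification of the points of a vertex *)

Lemma geom_gt0 a b n : 0 < a -> 0 < b -> 0 < geom a b n.
Proof. by elim: n a b => //= n IH a b a0 b0; rewrite mulr_gt0 ?IH. Qed.

Lemma geomS_lt a b n : 0 < a < 1 -> 0 < b < 1 -> geom a b n.+1 < geom a b n.
Proof.
elim: n a b => [|n IH] a b ha hb; first by rewrite /= mulr1; lra.
by rewrite [ltLHS]/= [ltRHS]/= ltr_pM2l ?IH //; lra.
Qed.

Lemma geom_le a b m n : 0 < a < 1 -> 0 < b < 1 ->
  (geom a b m <= geom a b n) = (n <= m)%N.
Proof.
move=> ha hb.
by rewrite (Order.NatMonotonyTheory.decnP (fun k => geomS_lt k ha hb)) leEnat.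
Qed.

Lemma geom_le1 a b n : 0 < a < 1 -> 0 < b < 1 -> geom a b n <= 1.
Proof. by move=> ha hb; rewrite -[leRHS]/(geom a b 0) geom_le. Qed.

(** A Bernoulli-type inequality bounds [c ^+ n] by 1 / (1 + n (1 - c)). This limits the length of a
    zigzag. *)
Lemma expr_lt_pos c x : 0 < c < 1 -> 0 < x -> exists n, c ^+ n < x.
Proof.
move=> hc x0.
have bern n : c ^+ n * (1 + n%:R * (1 - c)) <= 1.
  elim: n => [|n IH]; first by rewrite expr0 mul0r addr0 mulr1.
  apply: le_trans IH; rewrite exprSr -mulrA ler_pM2l ?exprn_gt0 ?(andP hc).1 //.
  rewrite -natr1 -subr_ge0.
  have -> : 1 + n%:R * (1 - c) - c * (1 + (n%:R + 1) * (1 - c))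
            = (1 - c) ^+ 2 * (n%:R + 1) by ring.
  by rewrite mulr_ge0 ?sqr_ge0 ?addr_ge0.
pose y := (x * (1 - c))^-1.
have y0 : 0 < y by rewrite invr_gt0 mulr_gt0 //; lra.
exists (Num.bound y); have := archi_boundP (ltW y0); set N := Num.bound y => hN.
have : 1 < N%:R * (x * (1 - c)).
  by rewrite -ltr_pdivrMr ?div1r // mulr_gt0 //; lra.
have := bern N; have : 0 < c ^+ N by rewrite exprn_gt0 ?(andP hc).1.
set z := c ^+ N => z0 h1 h2; rewrite ltNge; apply/negP => xz.
have : 0 <= (z - x) * (N%:R * (1 - c)).
  by rewrite !mulr_ge0 ?subr_ge0 //; lra.
nra.
Qed.

(* The zigzag from a corner that reaches the bottom side [Y = 0] at its point
   of index [n]. *)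
Definition zigzag a b n m : R * R :=
  if odd (n + m) then (0, geom a b m) else (geom b a m, 0).

Lemma zigzag_swap a b n m : swap (zigzag a b n.+1 m) = zigzag b a n m.
Proof. by rewrite /zigzag addSn /=; case: (odd _). Qed.

(** The piece given by [occupied_bottom] is on a line of the other direction at level [t / a].
    Exchange the axes and repeat: once the level is too large for [occupied_bottom],
    [no_transversal] forces it to be 1, at a corner. *)
Lemma occupied_zigzag q a b (w : 'I_q -> R * R) i :
    0 < a < 1 -> 0 < b < 1 -> rigid_in_square a b w -> 0 < tc a (w i) <= a ->
  exists2 n, tc a (w i) = geom a b n.+1 &
             forall m, (m <= n)%N -> occupied w (zigzag a b n m).
Proof.
move=> ha hb rw ti.
(* The induction exchanges [a] and [b]; a common bound [c] lets [t < c ^+ N] descend in [N] at every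
   step. *)
have [c [ac bc c1]] : exists c, [/\ a <= c, b <= c & c < 1].
  by exists (Num.max a b); rewrite !le_max gt_max !lexx orbT; split => //; lra.
have hc : 0 < c < 1 by lra.
have [N] := expr_lt_pos hc (andP ti).1.
elim: N a b w i ha hb rw ti ac bc => [|N IH] a b w i ha hb rw ti ac bc hN.
  by rewrite expr0 in hN; lra.
have [j wj] := occupied_bottom ha hb rw ti.
set t := tc a (w i) in ti wj hN *.
have rs := rigid_in_square_swap rw.
have sj : tc b ((swap \o w) j) = t / a by rewrite /tc /= wj /=; ring.
have tE : t = a * (t / a) by field; lra.
have s0 : 0 < t / a by rewrite divr_gt0 //; lra.
have s1 : t / a <= 1 by rewrite ler_pdivrMr; lra.
have [sb|] := leP (t / a) b; last first.
  rewrite -sj => sb; have := no_transversal (i := j) hb ha rs.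
  rewrite sb /= sj => /negP; rewrite -leNgt => s1'.
  have sE : t / a = 1 by lra.
  exists 0%N => [|[] // _]; first by rewrite tE sE.
  by exists j; rewrite wj sE.
have [||n sE occ] := IH b a (swap \o w) j hb ha rs _ bc ac; rewrite ?sj.
- by rewrite s0.
- rewrite exprS in hN; rewrite ltr_pdivlMr; last lra.
  apply: le_lt_trans hN; rewrite mulrC ler_wpM2r // exprn_ge0 //; lra.
exists n.+1 => [|m]; first by rewrite tE -sj sE.
rewrite leq_eqVlt => /predU1P[->|/occ[k wk]]; last first.
  by exists k; rewrite -[w k]swapK [swap (w k)]wk -zigzag_swap swapK.
by exists j; rewrite wj /zigzag addnn odd_double -sj sE.
Qed.

Lemma geom_inj a b : 0 < a < 1 -> 0 < b < 1 -> injective (geom a b).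
Proof.
by move=> ha hb m n e; apply/eqP; rewrite eqn_leq -!(geom_le _ _ ha hb) e lexx.
Qed.

Lemma occupied_size q (w : 'I_q -> R * R) (s : seq (R * R)) :
  uniq s -> {in s, forall p, occupied w p} -> (size s <= q)%N.
Proof.
move=> us os; rewrite -[q in leqRHS]card_ord -(size_codom w).
by apply: uniq_leq_size => // p /os[i <-]; apply: codom_f.
Qed.

Lemma zigzag_size q a b (w : 'I_q -> R * R) n : 0 < a < 1 -> 0 < b < 1 ->
  (forall m, (m <= n)%N -> occupied w (zigzag a b n m)) -> (n < q)%N.
Proof.
move=> ha hb occ.
have inj : injective (zigzag a b n).
  have g0 c d k : 0 < c < 1 -> 0 < d < 1 -> geom c d k <> 0.
    by move=> /andP[c0 _] /andP[d0 _]; have := geom_gt0 k c0 d0; lra.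
  move=> k l; rewrite /zigzag; case: ifP => _; case: ifP => _ [] //.
  - exact: geom_inj.
  - by move=> /esym/g0; case.
  - by move=> /g0; case.
  - exact: geom_inj.
have := @occupied_size q w (map (zigzag a b n) (iota 0 n.+1)).
rewrite map_inj_uniq // iota_uniq size_map size_iota; apply=> //.
by move=> p /mapP[m]; rewrite mem_iota => /andP[_ hm] ->; apply: occ.
Qed.

Lemma crossing_gt0 a b n : 0 < a < 1 -> 0 < b < 1 ->
  0 < (crossing a b n).1 /\ 0 < (crossing a b n).2.
Proof.
move=> ha hb; have ab : a * b < 1 by nra.
by split; rewrite divr_gt0 ?subr_gt0 // geomS_lt.
Qed.

Lemma crossing_size q a b (w : 'I_q -> R * R) n : 0 < a < 1 -> 0 < b < 1 ->
    (forall m, (m <= n)%N -> occupied w (zigzag a b n m)) ->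
    (forall m, (m <= n)%N -> occupied w (zigzag a b n.+1 m)) ->
  occupied w (crossing a b n) -> (n.*2 + 3 <= q)%N.
Proof.
move=> ha hb occ occ' occ0.
have [c1 c2] := crossing_gt0 n ha hb.
have g0 k : 0 < geom a b k by apply: geom_gt0; lra.
(* The two zigzags are in opposite phase, so together they visit both axes at every index up to [n];
   grouping by axis makes the points visibly distinct. *)
pose s := [seq (geom b a m, 0 : R) | m <- iota 0 n.+1] ++
          [seq (0 : R, geom a b m) | m <- iota 0 n.+1].
suff /(@occupied_size q w) H : uniq (crossing a b n :: s).
  have -> : (n.*2 + 3 = size (crossing a b n :: s))%N.
    by rewrite -[RHS]/((size s).+1) size_cat !size_map !size_iota -addnn; lia.
  apply: H => p; rewrite inE => /predU1P[-> //|].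
  rewrite mem_cat => /orP[]/mapP[m]; rewrite mem_iota => /andP[_ hm] ->;
    have := occ m hm; have := occ' m hm; rewrite /zigzag addSn /=;
    by case: (odd _).
rewrite cons_uniq.
rewrite mem_cat cat_uniq !map_inj_uniq ?iota_uniq; first last.
- by move=> k l [] /(geom_inj hb ha).
- by move=> k l [] /(geom_inj ha hb).
rewrite !andbT; apply/andP; split.
  by apply/negP => /orP[] /mapP[m _ e]; move: c1 c2; rewrite e /=; lra.
apply/hasPn => p /mapP[m _ ->]; apply/negP => /mapP[k _ [_]].
by have := g0 m; lra.
Qed.

(** Apart from the corners [(0, 0)] and [(1, 0)], the point is on lines of levels [geom a b n.+1]
    and [geom b a l.+1]. Nonnegative coordinates force [n] and [l] to differ by at most 1: equality
    gives a crossing, otherwise the point is on a side. *)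
Lemma rigid_point q a b (w : 'I_q -> R * R) i :
    0 < a < 1 -> 0 < b < 1 -> rigid_in_square a b w -> tc a (w i) <= a ->
  [\/ w i = (0, 0),
      exists2 m, (m < q)%N & w i = (0, geom a b m) \/ w i = (geom b a m, 0) |
      exists2 n, (n.*2 + 3 <= q)%N & w i = crossing a b n].
Proof.
move=> ha hb rw ta; have rs := rigid_in_square_swap rw.
have ab1 : a * b < 1 by nra.
have := rw.2 i; set X := (w i).1; set Y := (w i).2.
have wE : w i = (X, Y) by rewrite /X /Y; case: (w i).
rewrite /in_square -/X -/Y => hXY.
have tE : tc a (w i) = Y + a * X by [].
have sE : tc b ((swap \o w) i) = X + b * Y by [].
have [t0|t0] := leP (tc a (w i)) 0.
  apply: Or31; rewrite wE; congr (_, _); nra.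
have s0 : 0 < tc b ((swap \o w) i) by rewrite sE; nra.
have s1 : tc b ((swap \o w) i) <= 1 by rewrite sE; nra.
have [sb|] := leP (tc b ((swap \o w) i)) b; last first.
  move=> sb; have := no_transversal (i := i) hb ha rs.
  rewrite sb /= => /negP; rewrite -leNgt => s1'.
  apply: Or32; exists 0%N; first by apply: leq_trans (ltn_ord i).
  have X1 : X = 1 by nra.
  right; rewrite wE X1; congr (_, _); nra.
have [|n tn occ] := occupied_zigzag (i := i) ha hb rw; first by rewrite t0.
have [|l sl occ'] := occupied_zigzag (i := i) hb ha rs; first by rewrite s0.
have {}occ' m : (m <= l)%N -> occupied w (zigzag a b l.+1 m).
  move=> /occ'[k wk]; exists k.
  by rewrite -[w k]swapK [swap (w k)]wk -zigzag_swap swapK.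
have bX : X * (1 - a * b) = geom b a l.+1 - geom b a n.+2.
  rewrite -sl [geom b a n.+2]/= -[a * geom b a n]/(geom a b n.+1) -tn sE tE.
  by ring.
have bY : Y * (1 - a * b) = geom a b n.+1 - geom a b l.+2.
  rewrite -tn [geom a b l.+2]/= -[b * geom a b l]/(geom b a l.+1) -sl sE tE.
  by ring.
have ln : (l <= n.+1)%N.
  by rewrite -ltnS -(geom_le _ _ hb ha) -subr_ge0 -bX mulr_ge0; lra.
have nl : (n <= l.+1)%N.
  by rewrite -ltnS -(geom_le _ _ ha hb) -subr_ge0 -bY mulr_ge0; lra.
have D0 : 1 - a * b != 0 by lra.
have [lE|lE|lE] : [\/ l = n, l = n.+1 | n = l.+1].
  by clear -ln nl; case: (ltngtP l n) => [?|?|];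
    [apply: Or33|apply: Or32|apply: Or31]; lia.
- have wC : w i = crossing a b n.
    rewrite wE /crossing; congr (_, _); apply: (mulIf D0);
      by rewrite ?bX ?bY divfK // lE.
  apply: Or33; exists n.
    apply: (crossing_size ha hb occ) => [m hm|]; last by exists i.
    by rewrite -lE; apply: occ'; rewrite lE.
  exact: wC.
- apply: Or32; exists l.
    apply: (@zigzag_size _ b a (swap \o w)) => // m /occ'[k wk].
    by exists k; rewrite /= wk zigzag_swap.
  left; rewrite wE.
  have X0 : X = 0 by apply: (mulIf D0); rewrite bX lE subrr mul0r.
  by rewrite X0 lE -tn tE X0 mulr0 addr0.
- apply: Or32; exists n; first exact: (zigzag_size ha hb occ).
  right; rewrite wE.
  have Y0 : Y = 0 by apply: (mulIf D0); rewrite bY lE subrr mul0r.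
  by rewrite Y0 lE -sl sE Y0 mulr0 addr0.
Qed.

Lemma low_or_mirror_low q a b (w : 'I_q -> R * R) i :
    0 < a < 1 -> 0 < b < 1 -> rigid_in_square a b w ->
  tc a (w i) <= a \/ tc a (mirror (w i)) <= a.
Proof.
move=> ha hb rw; have := no_transversal (i := i) ha hb rw; rewrite tc_mirror.
case: (leP (tc a (w i)) a) => [|h]; first by left.
by move=> /= /negP; rewrite -leNgt; right; lra.
Qed.

(** * Configurations realising zigzag ends and crossings *)

Lemma compatible_zigzag q a b (w w' : 'I_q -> R * R) N n :
    compatible a b w w' ->
    (forall m, (m <= n)%N -> occupied w (zigzag a b N m)) ->
  forall m i, (m <= n)%N -> w i = zigzag a b N m -> w' i = w i.
Proof.
(* The corner is fixed by its two sides, each later piece by its side and the line shared with its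
   predecessor. *)
move=> cw occ; elim=> [|m IH] i mn wi.
  rewrite [w' i]surjective_pairing [w i in RHS]surjective_pairing.
  by congr (_, _); [apply: compat_X cw _ _|apply: compat_Y cw _ _];
    rewrite wi /zigzag; case: odd; rewrite !inE eqxx ?orbT.
have [j wj] := occ m (ltnW mn); have := IH j (ltnW mn) wj.
move: wi wj; rewrite /zigzag addnS /=; case: odd => /= wi wj w'j.
  have /(compat_s cw) : tc b (swap (w i)) = tc b (swap (w j)).
    by rewrite wi wj /tc /=; ring.
  have : (w' i).2 = (w i).2 by apply: (compat_Y cw); rewrite wi !inE eqxx.
  rewrite w'j wi wj /tc /=; case: (w' i) => X Y /= ->.
  by rewrite mulr0 addr0 add0r => ->.
have /(compat_t cw) : tc a (w i) = tc a (w j) by rewrite wi wj /tc /=; ring.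
have : (w' i).1 = (w i).1 by apply: (compat_X cw); rewrite wi !inE eqxx.
rewrite w'j wi wj /tc /=; case: (w' i) => X Y /= ->.
by rewrite mulr0 addr0 add0r => ->.
Qed.

(** Surplus pieces are parked at [(1, 0)], where two sides hold them. *)
Definition place q (s : seq (R * R)) (j : 'I_q) : R * R := nth (1, 0) s j.

Lemma place_occupied q s p :
  (size s <= q)%N -> p \in s -> occupied (@place q s) p.
Proof.
move=> sq ps; have iq : (index p s < q)%N.
  by apply: leq_trans sq; rewrite index_mem.
by exists (Ordinal iq); rewrite /place nth_index.
Qed.

Lemma place_mem q s (j : 'I_q) : place s j \in (1, 0) :: s.
Proof.
rewrite /place inE; have [js|sj] := ltnP j (size s).
  by rewrite mem_nth ?orbT.
by rewrite nth_default ?eqxx.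
Qed.

Lemma zigzag_in_square a b n m : 0 < a < 1 -> 0 < b < 1 ->
  in_square (zigzag a b n m).
Proof.
move=> ha hb.
have g c d : 0 < c < 1 -> 0 < d < 1 -> 0 <= geom c d m <= 1.
  move=> hc hd; rewrite geom_le1 // ltW ?geom_gt0 //; lra.
by rewrite /zigzag /in_square; case: odd; rewrite /= ?g // lexx ler01.
Qed.

Lemma compatible_corner q a b (w w' : 'I_q -> R * R) i :
  compatible a b w w' -> w i = (1, 0) -> w' i = w i.
Proof.
move=> cw wi; rewrite [w' i]surjective_pairing [w i in RHS]surjective_pairing.
by congr (_, _); [apply: compat_X cw _ _|apply: compat_Y cw _ _];
    rewrite wi !inE eqxx ?orbT.
Qed.

Definition zigzag_seq a b N n := map (zigzag a b N) (iota 0 n.+1).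

Lemma mem_zigzag_seq a b N n m :
  (m <= n)%N -> zigzag a b N m \in zigzag_seq a b N n.
Proof. by move=> mn; apply: map_f; rewrite mem_iota. Qed.

Lemma rigid_place_zigzag q a b n : 0 < a < 1 -> 0 < b < 1 -> (n < q)%N ->
  rigid_in_square a b (@place q (zigzag_seq a b n n)).
Proof.
move=> ha hb nq; split=> [w' cw i|i].
  have occ m : (m <= n)%N ->
      occupied (@place q (zigzag_seq a b n n)) (zigzag a b n m).
    move=> mn; apply: place_occupied; rewrite ?size_map ?size_iota //.
    exact: mem_zigzag_seq.
  have := place_mem (zigzag_seq a b n n) i.
  rewrite inE => /predU1P[wi|/mapP[m]].
    exact: (compatible_corner cw).
  by rewrite mem_iota => /andP[_ mn] wi; apply: (compatible_zigzag cw occ) mn wi.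
have := place_mem (zigzag_seq a b n n) i.
rewrite inE => /predU1P[->|/mapP[m _ ->]].
  by rewrite /in_square /= !lexx !ler01.
exact: zigzag_in_square.
Qed.

Lemma crossing_in_square a b n : 0 < a < 1 -> 0 < b < 1 ->
  in_square (crossing a b n).
Proof.
move=> ha hb; have [c1 c2] := crossing_gt0 n ha hb.
have ab1 : 0 < 1 - a * b by nra.
have le1 c d : 0 < c < 1 -> 0 < d < 1 ->
    geom c d n.+1 - geom c d n.+2 <= 1 - c * d.
  move=> hc hd; have := geom_le1 n hd hc.
  have : geom d c n.+2 <= geom d c n.+1 by rewrite geom_le.
  have : 0 < geom d c n by apply: geom_gt0; lra.
  rewrite [geom c d n.+2]/= -[d * geom c d n]/(geom d c n.+1) /=.
  set g := geom d c n; set h := geom c d n => g0 gh g1.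
  have cg : c * g <= 1 by nra.
  have cd : c * d <= 1 by nra.
  have : c * (d * (c * g)) <= c * (d * h) by rewrite ler_wpM2l //; lra.
  have : 0 <= (1 - c * g) * (1 - c * d) by rewrite mulr_ge0 // subr_ge0.
  lra.
rewrite /in_square (ltW c1) (ltW c2) /= !ler_pdivrMr // !mul1r le1 // andbT.
have -> : 1 - a * b = 1 - b * a by ring.
exact: le1.
Qed.

Lemma tc_crossing a b n : a * b != 1 -> tc a (crossing a b n) = geom a b n.+1.
Proof.
move=> ab1; rewrite /tc /=; field.
by rewrite subr_eq0 eq_sym.
Qed.

Lemma crossing_swap a b n : swap (crossing a b n) = crossing b a n.
Proof. by rewrite /crossing /swap [a * b]mulrC. Qed.

Definition crossing_seq a b n :=
  crossing a b n :: zigzag_seq a b n n ++ zigzag_seq a b n.+1 n.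

Lemma rigid_place_crossing q a b n : 0 < a < 1 -> 0 < b < 1 ->
  (n.*2 + 3 <= q)%N -> rigid_in_square a b (@place q (crossing_seq a b n)).
Proof.
move=> ha hb nq; set s := crossing_seq a b n; set w := @place q s.
have ss : (size s <= q)%N.
  rewrite -[size s]/((size (zigzag_seq a b n n ++ zigzag_seq a b n.+1 n)).+1).
  by rewrite size_cat !size_map !size_iota; lia.
have occ m : (m <= n)%N -> occupied w (zigzag a b n m).
  move=> mn; apply: place_occupied ss _.
  by rewrite inE mem_cat mem_zigzag_seq ?orbT.
have occ' m : (m <= n)%N -> occupied w (zigzag a b n.+1 m).
  move=> mn; apply: place_occupied ss _.
  by rewrite inE mem_cat mem_zigzag_seq ?orbT.
have memw i : [\/ w i = (1, 0), w i = crossing a b n,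
   exists2 m, (m <= n)%N & w i = zigzag a b n m |
   exists2 m, (m <= n)%N & w i = zigzag a b n.+1 m].
  have := place_mem s i; rewrite inE => /predU1P[|]; first by constructor 1.
  rewrite inE => /predU1P[|]; first by constructor 2.
  by rewrite mem_cat => /orP[]/mapP[m]; rewrite mem_iota => /andP[_ mn];
    [constructor 3|constructor 4]; exists m.
have ab1 : a * b < 1 by nra.
split=> [w' cw i|i]; last first.
  case: (memw i) => [->|->|[m _ ->]|[m _ ->]];
    rewrite ?zigzag_in_square ?crossing_in_square //.
  by rewrite /in_square /= !lexx !ler01.
have fix1 := compatible_zigzag cw occ; have fix2 := compatible_zigzag cw occ'.
case: (memw i) => [|wi|[m mn /(fix1 _ _ mn)]|[m mn /(fix2 _ _ mn)]] //.
  exact: (compatible_corner cw).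
(* The crossing is fixed by its two lines, each through the last piece of one zigzag. *)
have [j wj] := occ n (leqnn n); have [k wk] := occ' n (leqnn n).
have := fix1 _ _ (leqnn n) wj; have := fix2 _ _ (leqnn n) wk.
rewrite wj wk /zigzag addSn /= addnn odd_double /= => w'k w'j.
have /(compat_t cw) : tc a (w i) = tc a (w j).
  rewrite wi tc_crossing; last by lra.
  by rewrite wj /zigzag addnn odd_double /tc /= add0r.
have /(compat_s cw) : tc b (swap (w i)) = tc b (swap (w k)).
  rewrite wi crossing_swap tc_crossing; last by lra.
  by rewrite wk /zigzag addSn addnn /= odd_double /tc /= add0r.
rewrite w'j w'k /tc /= !add0r wi /crossing; case: (w' i) => X Y /= e1 e2.
have D0 : 1 - a * b != 0 by lra.
by congr (_, _); apply: (mulIf D0); rewrite divfK // -e1 -e2; ring.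
Qed.

End Plane.

(** * Vertices as rigid configurations *)

(* Coordinates centred at the corner [(1, 0)], where the zigzags accumulate. *)
Definition flip (R : realType) (p : R * R) : R * R := (1 - p.1, p.2).

Lemma attack_hyperplane1P (R : realType) q (c d : int) (i j : 'I_q)
    (z : config R q) :
  c != 0 ->
  attack_hyperplane (c, d) i j z <->
  tc (d%:~R / c%:~R) (flip (z i)) = tc (d%:~R / c%:~R) (flip (z j)).
Proof.
rewrite -(intr_eq0 R) /attack_hyperplane /tc /flip /= => c0.
set C := c%:~R in c0 *; set D := d%:~R.
have E : ((z i).1 - (z j).1) * D + ((z i).2 - (z j).2) * - C =
  C * ((z j).2 + D / C * (1 - (z j).1) - ((z i).2 + D / C * (1 - (z i).1))).
  by field.
rewrite E; split=> [/eqP|->]; last by rewrite subrr mulr0.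
by rewrite mulf_eq0 (negbTE c0) subr_eq0 => /eqP.
Qed.

Lemma attack_hyperplane2P (R : realType) q (c d : int) (i j : 'I_q)
    (z : config R q) :
  d != 0 ->
  attack_hyperplane (c, d) i j z <->
  tc (c%:~R / d%:~R) (swap (flip (z i))) =
  tc (c%:~R / d%:~R) (swap (flip (z j))).
Proof.
rewrite -(intr_eq0 R) /attack_hyperplane /tc /flip /= => d0.
set C := c%:~R; set D := d%:~R in d0 *.
have E : ((z i).1 - (z j).1) * D + ((z i).2 - (z j).2) * - C =
  D * (1 - (z j).1 + C / D * (z j).2 - (1 - (z i).1 + C / D * (z i).2)).
  by field.
rewrite E; split=> [/eqP|->]; last by rewrite subrr mulr0.
by rewrite mulf_eq0 (negbTE d0) subr_eq0 => /eqP.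
Qed.

Lemma flipK (R : realType) : involutive (@flip R).
Proof. by case=> x y; rewrite /flip /=; congr (_, _); ring. Qed.

Lemma unit_cubeP (R : realType) q (z : config R q) :
  unit_cube z <-> forall i, in_square (flip (z i)).
Proof.
rewrite /unit_cube /in_square /flip /=; split=> h i; have := h i.
  by case; lra.
by split; lra.
Qed.

(** A compatible configuration stays on every hyperplane of the given collection, hence is the same
    point. Conversely, the collection of all hyperplanes through [z] serves. *)
Lemma is_vertexP (R : realType) q (c1 d1 c2 d2 : int) (z : config R q) :
    c1 != 0 -> d2 != 0 ->
  is_vertex (c1, d1) (c2, d2) z <->
  rigid_in_square (d1%:~R / c1%:~R) (c2%:~R / d2%:~R) (fun i => flip (z i)).
Proof.
move=> c10 d20; have P1 := attack_hyperplane1P d1 _ _ _ c10.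
have P2 := attack_hyperplane2P c2 _ _ _ d20.
split=> [[/unit_cubeP cz [C sC Cz]]|[rz cz]].
  split=> // w' [ct cs cX cY] i.
  pose z' : config R q := [ffun j => flip (w' j)].
  have z'E j : flip (z' j) = w' j by rewrite ffunE flipK.
  rewrite -z'E; suff -> : z' = z by [].
  have zC H : C H -> H z.
    by move=> CH; have : [set z] z by []; rewrite -Cz; apply.
  suff : (\bigcap_(H in C) H) z' by rewrite Cz.
  move=> H CH; have := zC H CH.
  have x1 j : (z' j).1 = 1 - (w' j).1 by rewrite ffunE.
  have y1 j : (z' j).2 = (w' j).2 by rewrite ffunE.
  case: (sC H CH) => [[m [j [k [mm jk ->]]]]|[j]].
    move: mm; rewrite !inE => /orP[]/eqP->.
      by rewrite !P1 !z'E; apply: ct.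
    by rewrite !P2 !z'E; apply: cs.
  case=> -> /= e; rewrite ?x1 ?y1.
  - rewrite cX /= e ?inE ?subr0 ?eqxx ?orbT //; ring.
  - rewrite cX /= e ?inE ?subrr ?eqxx ?orbT //; ring.
  - rewrite cY /= e ?inE ?eqxx ?orbT //.
  - rewrite cY /= e ?inE ?eqxx ?orbT //.
split; first exact/unit_cubeP.
pose HH := attack_equations (c1, d1) (c2, d2) `|` @fixations R q.
exists [set H | HH H /\ H z]; first by move=> H [].
apply/seteqP; split=> [z' Hz'|_ -> H []] //.
suff e : (fun i => flip (z' i)) =1 (fun i => flip (z i)).
  by apply/ffunP => i; rewrite -[z' i]flipK -[z i]flipK; congr flip; apply: e.
apply: rz; split=> [i j e|i j e|i|i].
- have [->//|ij] := eqVneq i j.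
  apply/P1; apply: Hz'; split; last exact/P1.
  by left; exists (c1, d1), i, j; rewrite inE eqxx.
- have [->//|ij] := eqVneq i j.
  apply/P2; apply: Hz'; split; last exact/P2.
  by left; exists (c2, d2), i, j; rewrite !inE eqxx orbT.
- rewrite !inE /= => /orP[]/eqP e.
    have e1 : (z i).1 = 1 by lra.
    rewrite e1; congr (1 - _); apply: (Hz' [set z | (z i).1 = 1]); split => //.
    by right; exists i; constructor 2.
  have e1 : (z i).1 = 0 by lra.
  rewrite e1; congr (1 - _); apply: (Hz' [set z | (z i).1 = 0]); split => //.
  by right; exists i; constructor 1.
- rewrite !inE /= => /orP[]/eqP e.
    rewrite e; apply: (Hz' [set z | (z i).2 = 0]); split => //.
    by right; exists i; constructor 3.
  rewrite e; apply: (Hz' [set z | (z i).2 = 1]); split => //.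
  by right; exists i; constructor 4.
Qed.

(** * Denominators of the two sequences *)

Lemma real_denom_ratr (R : realType) (r : rat) :
  real_denom (ratr r : R) = rat_denom r.
Proof.
rewrite /real_denom; case: pselect => [h|[]]; last by exists r.
congr rat_denom; apply: (fmorph_inj (ratr : {rmorphism rat -> R})).
exact/esym/(projT2 (cid h)).
Qed.

Lemma rat_denomN (r : rat) : rat_denom (- r) = rat_denom r.
Proof. by rewrite /rat_denom denqN. Qed.

Lemma rat_denom_int (n : int) : rat_denom n%:~R = 1%N.
Proof. by rewrite /rat_denom denq_int. Qed.

(** The new numerator is still coprime to the denominator. Hence neither [flip] nor [mirror] affects
    denominators. *)
Lemma rat_denom_compl (r : rat) : rat_denom (1 - r) = rat_denom r.
Proof.
have d0 : (denq r)%:~R != 0 :> rat by rewrite intr_eq0 denq_eq0.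
have -> : 1 - r = (denq r - numq r)%:~R / (denq r)%:~R.
  by rewrite -{1}[r]divq_num_den intrB; field.
rewrite /rat_denom coprimeq_den ?denq_eq0 ?absz_id ?absz_nat //.
have := coprime_num_den r; rewrite coprime_sym [in X in _ -> X]coprime_sym.
by rewrite -!coprimezE /coprimez -(gcdzN (denq r) (numq r)) gcdzDl.
Qed.

Lemma real_denom_compl (R : realType) (r : rat) :
  real_denom (1 - ratr r : R) = rat_denom r.
Proof.
rewrite -(rmorph1 (ratr : {rmorphism rat -> R})) -rmorphB.
by rewrite real_denom_ratr rat_denom_compl.
Qed.

Lemma geomE (K : fieldType) (a b : K) n :
  geom a b n = (if odd n then a else 1) * (a * b) ^+ n./2.
Proof.
elim: n a b => [|n IH] a b; first by rewrite expr0 mulr1.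
rewrite /= IH uphalf_half; case: odd => /=; last first.
  by rewrite mul1r add0n [b * a]mulrC.
by rewrite add1n exprS mul1r [b * a]mulrC; ring.
Qed.

Lemma geom_ratr (R : realType) (a b : rat) n :
  geom (ratr a) (ratr b) n = ratr (geom a b n) :> R.
Proof. by elim: n a b => [|n IH] a b /=; rewrite ?rmorph1 // rmorphM IH. Qed.

Lemma crossing_ratr (R : realType) (a b : rat) n :
  crossing (ratr a) (ratr b) n =
  (ratr (crossing a b n).1, ratr (crossing a b n).2) :> R * R.
Proof.
by congr (_, _); rewrite !geom_ratr fmorph_div !rmorphB (rmorphM _ a b) rmorph1.
Qed.

Lemma seq1_denom (c1 d1 c2 d2 : rat) m :
  let a := d1 / c1 in let b := c2 / d2 in
  point_denom (seq1 c1 d1 c2 d2 m.+1)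
  = lcmn (rat_denom (geom a b m)) (rat_denom (geom b a m)).
Proof.
move=> a b; rewrite /point_denom /seq1 !geomE [b * a]mulrC /=.
have -> : slope_ratio c1 d1 c2 d2 = a * b.
  by rewrite /slope_ratio /a /b mulf_div.
rewrite subn1 /=; case: (boolP (odd m)) => [om|em] /=.
  by have -> : (uphalf m - 1 = m./2)%N by rewrite uphalf_half om; lia.
(* For even [m] both products are the same power, and the coordinate 1 contributes nothing to the
   lcm. *)
by rewrite !mul1r -[1]/(1%:~R) rat_denom_int lcm1n (lcmn_idPl (dvdnn _)).
Qed.

(** The first coordinate in [seq2] is the opposite of that of the crossing, which leaves its
    denominator unchanged. *)
Lemma seq2_denom (c1 d1 c2 d2 : rat) n :
  let a := d1 / c1 in let b := c2 / d2 in
  c1 != 0 -> d2 != 0 -> move_det c1 d1 c2 d2 != 0 ->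
  point_denom (seq2 c1 d1 c2 d2 n.+1)
  = lcmn (rat_denom (crossing a b n).1) (rat_denom (crossing a b n).2).
Proof.
move=> a b c10 d20 D0; rewrite /point_denom /seq2 /crossing !geomE [b * a]mulrC.
have D0' : 1 - a * b != 0.
  have -> : 1 - a * b = move_det c1 d1 c2 d2 / (c1 * d2).
    by rewrite /a /b /move_det; field; rewrite c10 d20.
  by rewrite !mulf_neq0 // invr_eq0 mulf_neq0.
have rE : slope_ratio c1 d1 c2 d2 = a * b.
  by rewrite /slope_ratio /a /b mulf_div.
have dE : d1 = a * c1 by rewrite divfK.
have cE : c2 = b * d2 by rewrite divfK.
rewrite rE /move_det; clearbody a b; rewrite {}dE {}cE {rE D0}.
have -> : c1 * d2 - b * d2 * (a * c1) = c1 * d2 * (1 - a * b) by ring.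
rewrite subn1 /= uphalf_half.
case: (boolP (odd n)) => [om|em] /=; rewrite ?add1n ?add0n ?exprS -rat_denomN;
  by congr (lcmn (rat_denom _) (rat_denom _)); field; rewrite c10 d20 D0'.
Qed.

Lemma slopes_in_unit (c1 d1 c2 d2 : int) :
    0 < d1%:Q / c1%:Q -> d1%:Q / c1%:Q < 1 -> 1 < d2%:Q / c2%:Q ->
  [/\ c1 != 0, d2 != 0, 0 < d1%:Q / c1%:Q < 1 & 0 < c2%:Q / d2%:Q < 1].
Proof.
move=> h0 h1 h2.
(* A quotient by 0 is 0, so a positive first slope excludes [c1 = 0]; [d2 = 0] would make the second
   slope 0. *)
have c10 : c1 != 0 by apply: contraTneq h0 => ->; rewrite invr0 mulr0 ltxx.
have d20 : d2 != 0 by apply: contraTneq h2 => ->; rewrite mul0r ltr10.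
split=> //; first by rewrite h0.
rewrite -[_ / d2%:Q]invf_div invr_gt0 invf_lt1; lra.
Qed.

(** * The two divisibilities *)

Theorem theorem6p2 (R : realType) (q : nat) (c1 d1 c2 d2 : int)
    (rider : two_move_rider (c1, d1) (c2, d2))
    (slope1_gt0 : 0 < d1%:Q / c1%:Q)
    (slope1_lt1 : d1%:Q / c1%:Q < 1)
    (slope2_gt1 : 1 < d2%:Q / c2%:Q) :
  is_polytope_denom R q (c1, d1) (c2, d2)
    (lcmn
      (\big[lcmn/1%N]_(1 <= i < q.+1)
         point_denom (seq1 c1%:Q d1%:Q c2%:Q d2%:Q i))
      (\big[lcmn/1%N]_(1 <= i < ((q - 1) %/ 2).+1)
         point_denom (seq2 c1%:Q d1%:Q c2%:Q d2%:Q i))).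
Proof.
have [c10 d20 ha hb] := slopes_in_unit slope1_gt0 slope1_lt1 slope2_gt1.
have c10Q : c1%:Q != 0 by rewrite intr_eq0.
have d20Q : d2%:Q != 0 by rewrite intr_eq0.
have D0 : move_det c1%:Q d1%:Q c2%:Q d2%:Q != 0.
  case: rider => _ _.
  by rewrite /nonparallel /= /move_det -!intrM -intrB intr_eq0.
rewrite !big_add1 /= !big_mkord.
under eq_bigr => m _ do rewrite seq1_denom.
under [X in lcmn _ X]eq_bigr => m _ do rewrite seq2_denom //.
have hP (z : config R q) := is_vertexP d1 c2 z c10 d20.
move: ha hb hP; set a := d1%:Q / c1%:Q; set b := c2%:Q / d2%:Q => ha hb.
have -> : d1%:~R / c1%:~R = ratr a :> R by rewrite /a fmorph_div !rmorph_int.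
have -> : c2%:~R / d2%:~R = ratr b :> R by rewrite /b fmorph_div !rmorph_int.
move=> hP.
have unit (r : rat) : 0 < r < 1 -> 0 < (ratr r : R) < 1.
  by rewrite -(ltr0q R) -(ltr_rat R r 1) rmorph1.
move: ha hb => /unit ha /unit hb.
split=> [_ [z /hP rz ->]|E hE].
  set D := lcmn _ _.
  (* Admitting [1 - ratr r] as well lets [good] survive the changes of origin by [flip] and
     [mirror]. *)
  pose good (x : R) :=
    exists2 r, x = ratr r \/ x = 1 - ratr r & (rat_denom r %| D)%N.
  have goodP x : good x -> (real_denom x %| D)%N.
    case=> r [->|->] rD; first by rewrite real_denom_ratr.
    by rewrite real_denom_compl.
  have goodC x : good (1 - x) -> good x.
    case=> r [] e rD; exists r => //; [right|left]; rewrite -?e; last by lra.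
    by ring.
  have good0 : good 0.
    exists 0; first by left; rewrite rmorph0.
    by rewrite -[0]/(0%:~R) rat_denom_int dvd1n.
  have goodg m : (m < q)%N ->
      good (geom (ratr a) (ratr b) m) /\ good (geom (ratr b) (ratr a) m).
    move=> mq; rewrite !geom_ratr.
    have : (lcmn (rat_denom (geom a b m)) (rat_denom (geom b a m)) %| D)%N.
      by apply: dvdn_trans (dvdn_lcml _ _); apply: (biglcmn_sup (Ordinal mq)).
    by rewrite dvdn_lcm => /andP[h1 h2]; split;
      [exists (geom a b m)|exists (geom b a m)] => //; left.
  have goodx n : (n.*2 + 3 <= q)%N ->
      good (crossing (ratr a) (ratr b) n).1 /\
      good (crossing (ratr a) (ratr b) n).2.
    move=> nq; rewrite crossing_ratr.
    (* [2 n + 3 <= q] says exactly that [n] is below the floor of (q - 1) / 2. *)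
    have nq' : (n < (q - 1) %/ 2)%N by lia.
    have : (lcmn (rat_denom (crossing a b n).1)
                 (rat_denom (crossing a b n).2) %| D)%N.
      apply: dvdn_trans (dvdn_lcmr _ _); exact: (biglcmn_sup (Ordinal nq')).
    by rewrite dvdn_lcm => /andP[h1 h2]; split;
      [exists (crossing a b n).1|exists (crossing a b n).2] => //; left.
  have good_low (w : 'I_q -> R * R) i :
      rigid_in_square (ratr a) (ratr b) w -> tc (ratr a) (w i) <= ratr a ->
      good (w i).1 /\ good (w i).2.
    move=> rw ti; case: (rigid_point ha hb rw ti) => [->|[m mq]|[n nq ->]] //.
      by have [g1 g2] := goodg m mq; case=> ->.
    exact: goodx.
  apply/dvdn_biglcmP => i _; rewrite dvdn_lcm.
  have [g1 g2] : good (1 - (z i).1) /\ good (z i).2.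
    have [ti|ti] := low_or_mirror_low i ha hb rz.
      exact: (good_low _ _ rz ti).
    by have [/goodC g1 /goodC g2] := good_low _ i (rigid_in_square_mirror rz) ti.
  by rewrite !goodP //; apply: goodC.
have Edvd (w : 'I_q -> R * R) i : rigid_in_square (ratr a) (ratr b) w ->
    (real_denom (1 - (w i).1) %| E)%N && (real_denom (w i).2 %| E)%N.
  move=> rw; pose z : config R q := [ffun j => flip (w j)].
  have vz : is_vertex (c1, d1) (c2, d2) z.
    apply/hP; congr (rigid_in_square _ _ _): rw.
    by apply/funext => j; rewrite ffunE flipK.
  have /dvdn_biglcmP/(_ i isT) := hE _ (ex_intro2 _ _ z vz erefl).
  by rewrite dvdn_lcm ffunE.
rewrite dvdn_lcm; apply/andP; split; apply/dvdn_biglcmP => -[m mq] _ /=;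
  rewrite dvdn_lcm.
  (* The last piece of a zigzag realises [geom d c m]; both orders of the slopes are needed, the
     second being carried back by [swap]. *)
  have end_zigzag c d : 0 < c < 1 -> 0 < d < 1 ->
      occupied (@place R q (zigzag_seq c d m m)) (geom d c m, 0).
    move=> hc hd; have -> : (geom d c m, 0) = zigzag c d m m.
      by rewrite /zigzag addnn odd_double.
    by apply: place_occupied; rewrite ?size_map ?size_iota ?mem_zigzag_seq.
  have [i wi] := end_zigzag _ _ ha hb; have [j wj] := end_zigzag _ _ hb ha.
  have /(Edvd _ i) := rigid_place_zigzag ha hb mq.
  rewrite wi /= geom_ratr real_denom_compl => /andP[-> _]; rewrite andbT.
  have /rigid_in_square_swap/(Edvd _ j) := rigid_place_zigzag hb ha mq.
  by rewrite /= wj /= geom_ratr real_denom_ratr => /andP[_ ->].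
have mq' : (m.*2 + 3 <= q)%N by clear -mq; lia.
have [i wi] : occupied (@place R q (crossing_seq (ratr a) (ratr b) m))
                       (crossing (ratr a) (ratr b) m).
  by exists (Ordinal (leq_trans (ltn0Sn _) (leq_trans (leq_addl _ _) mq'))).
have /(Edvd _ i) := rigid_place_crossing ha hb mq'.
by rewrite wi crossing_ratr /= real_denom_compl real_denom_ratr.
Qed.
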